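(* Let $n\ge1$, suppose $\lambda\ge\frac{n+2}{n}$ and $\gamma=\frac{n+2-\varepsilon}{2\lambda}$ for some $\varepsilon\in(0,1)$. Then there exists a $C^\infty$ positive solution $u$ of $u_t-\Delta u=0$ in $\mathbb{R}^n\times(0,\infty)$ such that $u\in L^\lambda(\mathbb{R}^n\times(0,T))$ for all $T>0$ and $u(0,t)=t^{-\gamma}$ for all $t>0$. *)

(* Defs.v *)
From mathcomp Require Import all_boot all_algebra.
From mathcomp Require Import all_classical all_reals all_analysis.
Import GRing.Theory Num.Theory numFieldNormedType.Exports.
Set Implicit Arguments. Unset Strict Implicit. Unset Printing Implicit Defensive.
Local Open Scope classical_set_scope.
Local Open Scope ring_scope.

Section Defs.
Variables (R : realType) (n : nat).

Local Notation pt := ('rV[R]_n * R)%type.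

Fixpoint iter_dir (vs : seq pt) (f : pt -> R) : pt -> R :=
  match vs with
  | [::] => f
  | v :: vs' => fun p => 'D_v (iter_dir vs' f) p
  end.

(* f is C^infinity on the set A (A will be open): all iterated directional
   derivatives exist and are continuous at every point of A *)
Definition smooth_on (A : set pt) (f : pt -> R) : Prop :=
  forall (vs : seq pt) (p : pt), A p ->
    {for p, continuous (iter_dir vs f)} /\
    (forall v : pt, derivable (iter_dir vs f) p v).

Definition upper_half : set pt := [set p | 0 < p.2].

Definition e_x (i : 'I_n) : pt := (delta_mx 0 i, 0).
Definition e_t : pt := (0, 1).

Definition heat_op (u : pt -> R) (p : pt) : R :=
  'D_e_t u p - \sum_(i < n) 'D_(e_x i) (fun q => 'D_(e_x i) u q) p.

(* Iterated Lebesgue integral over R^n of a function of x, integrating the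
   coordinates 0, 1, ..., k-1 (the others being frozen at those of x). *)
Fixpoint iint_coords (k : nat) (g : 'rV[R]_n -> \bar R) (x : 'rV[R]_n) : \bar R :=
  match k with
  | 0 => g x
  | k'.+1 => (\int[lebesgue_measure]_(y in [set: R])
               iint_coords k' g (\row_j (if nat_of_ord j == k' then y else x ord0 j)))%E
  end.

(* \int_{R^n} g(x) dx  for nonnegative g (by Tonelli, as an iterated integral) *)
Definition int_Rn (g : 'rV[R]_n -> \bar R) : \bar R := iint_coords n g 0.

Definition in_Llambda_strip (lambda T : R) (u : pt -> R) : Prop :=
  (\int[lebesgue_measure]_(t in `]0%R, T[)
      int_Rn (fun x => ((`|u (x, t)|) `^ lambda)%:E) < +oo)%E.

End Defs.

(* Main.v *)
From HB Require Import structures.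
Require Import Defs.
From mathcomp Require Import all_boot all_order all_algebra.
From mathcomp Require Import all_classical all_reals all_analysis.
From mathcomp Require Import measurable_realfun.
From mathcomp Require Import ring lra.
Import Order.TTheory GRing.Theory Num.Theory numFieldNormedType.Exports.
Local Open Scope classical_set_scope.
Local Open Scope ring_scope.
Set Implicit Arguments. Unset Strict Implicit. Unset Printing Implicit Defensive.

(**
Take the caloric extension of a multiple of [|x|^(-2 gamma)], which is
self-similar: [u (x, t) = t^(-gamma) f (|x|^2 / (4 t))], where, with [b = n/2]
and [a = b - gamma > 0], [f z = exp (- z) 1F1(a; b; z) = 1F1(gamma; b; - z)]
is a Kummer function. The second expression gives the heat equation, the first
one the positivity of [f] on [0, +oo[. All properties of [f] are read off the
power series coefficients: the contiguous relation
[f_b' = - (gamma/b) f_(b+1)] (hence smoothness), the ordinary differential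
equation [z f'' + (b + z) f' + gamma f = 0], and the inequality
[z f' + c f' + gamma f <= 0], which makes [(z + c)^gamma f] nonincreasing and so
[f z <= (1 + z/c)^(-gamma)]. Then the integral of [u^lambda] over R^n at time
[t] is at most a multiple of [t^(n/2 - gamma lambda) = t^(eps/2 - 1)], since
[2 gamma lambda > n].
*)

(** * Power series handled through their coefficients *)

Section power_series_sum.
Variable R : realType.
Implicit Types (c d : R^nat) (x s t : R).

(** A relation rather than a value: linear combinations of sums become linear combinations of
    coefficients, and [has_psum_unique] turns coefficient identities into identities between
    functions. *)
Definition has_psum c x s := pseries c x @ \oo --> s.

Lemma has_psum_unique c x s t : has_psum c x s -> has_psum c x t -> s = t.
Proof. by move=> h1 h2; exact: (cvg_unique _ h1 h2). Qed.

Lemma has_psumD c d x s t : has_psum c x s -> has_psum d x t ->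
  has_psum (fun k => c k + d k) x (s + t).
Proof.
move=> hc hd; rewrite /has_psum (_ : pseries _ _ = pseries c x + pseries d x).
  exact: cvgD.
apply/funext => N; rewrite /pseries /series /= fctE -big_split /=.
by apply: eq_bigr => i _; rewrite mulrDl.
Qed.

Lemma has_psumZ a c x s : has_psum c x s ->
  has_psum (fun k => a * c k) x (a * s).
Proof.
move=> hc; rewrite /has_psum (_ : pseries _ _ = (fun N => a * pseries c x N)).
  by apply: cvgM => //; exact: cvg_cst.
apply/funext => N; rewrite /pseries /series /= mulr_sumr.
by apply: eq_bigr => i _; rewrite mulrA.
Qed.

(** Handles the terms carrying a factor [z] in the differential equation and in the decay
    inequality. *)
Lemma has_psum_shift c x s : has_psum c x s ->
  has_psum (fun k => if k is j.+1 then c j else 0) x (x * s).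
Proof.
move=> hc; rewrite /has_psum -cvg_shiftS /=.
rewrite (_ : (fun _ => _) = (fun N => x * pseries c x N)).
  by apply: cvgM => //; exact: cvg_cst.
apply/funext => N; rewrite /pseries /series /= big_nat_recl //= mul0r add0r.
by rewrite mulr_sumr; apply: eq_bigr => i _; rewrite exprS mulrCA.
Qed.

Lemma has_psum_le c d x s t : 0 <= x -> (forall k, c k <= d k) ->
  has_psum c x s -> has_psum d x t -> s <= t.
Proof.
move=> x0 cd hc hd; rewrite -(cvg_lim _ hc)// -(cvg_lim _ hd)//.
apply: ler_lim; [by apply/cvg_ex; exists s|by apply/cvg_ex; exists t|].
apply: nearW => N; rewrite /pseries /series /=; apply: ler_sum => i _.
by rewrite ler_wpM2r// exprn_ge0.
Qed.

Lemma has_psum0 c : has_psum c 0 (c 0%N).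
Proof.
rewrite /has_psum -cvg_shiftS /= (_ : (fun _ => _) = cst (c 0%N)).
  exact: cvg_cst.
apply/funext => N; rewrite /pseries /series /= big_nat_recl //= expr0 mulr1.
by rewrite big1 ?addr0// => i _; rewrite expr0n mulr0.
Qed.

Lemma is_cvg_pseries_inv_fact c x : (forall k, `|c k| <= (k`!%:R)^-1) ->
  cvgn (pseries c x).
Proof.
move=> hc; apply: normed_cvg.
apply: (@series_le_cvg _ _ (exp_coeff `|x|)) => //.
- by move=> k; rewrite /= normr_ge0.
- by move=> k; rewrite exp_coeffE mulr_ge0 ?exprn_ge0// invr_ge0.
- by move=> k; rewrite exp_coeffE /= normrM normrX ler_wpM2r ?exprn_ge0.
- exact: is_cvg_series_exp_coeff.
Qed.

End power_series_sum.

(** * Kummer functions: contiguous relations, differential equation, decay *)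

Section kummer.
Variable R : realType.
Implicit Types (a b x z : R).

(** In Pochhammer symbols, [(a)_k / ((b)_k k!)]; the recursive form suits inductions on the ratio of
    consecutive coefficients. *)
Fixpoint kcoef a b k : R :=
  if k is j.+1 then kcoef a b j * ((a + j%:R) / ((b + j%:R) * j.+1%:R)) else 1.

Lemma kcoef_gt0 a b k : 0 < a -> 0 < b -> 0 < kcoef a b k.
Proof.
move=> a0 b0; elim: k => [|k IH] //=.
by rewrite mulr_gt0// divr_gt0 ?mulr_gt0 ?ltr_wpDr.
Qed.

(** Each ratio [(a + j) / (b + j)] is at most 1. Comparison with the exponential series then gives
    convergence everywhere. *)
Lemma kcoef_le a b k : 0 < a -> a <= b -> kcoef a b k <= (k`!%:R)^-1.
Proof.
move=> a0 ab; have b0 := lt_le_trans a0 ab.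
elim: k => [|k IH] /=; first by rewrite fact0 invr1.
rewrite factS natrM [leRHS]invfM [leRHS]mulrC; apply: ler_pM => //.
- by rewrite ltW// kcoef_gt0.
- by rewrite divr_ge0 ?mulr_ge0 ?addr_ge0 ?(ltW a0) ?(ltW b0).
rewrite invfM mulrA ler_piMl ?invr_ge0// ler_pdivrMr ?mul1r ?lerD2r//.
by rewrite ltr_wpDr.
Qed.

Lemma kcoef_succr a b k : 0 < b ->
  kcoef a (b + 1) k = kcoef a b k * (b / (b + k%:R)).
Proof.
move=> b0; elim: k => [|k IH] /=.
  by rewrite addr0 divff ?gt_eqF// mulr1.
rewrite IH -!natr1; have k0 : 0 <= k%:R :> R by [].
by field; rewrite !gt_eqF//; lra.
Qed.

Lemma kcoef_succlr a b k : 0 < a -> 0 < b ->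
  kcoef (a + 1) (b + 1) k = kcoef a b k * ((a + k%:R) * b / (a * (b + k%:R))).
Proof.
move=> a0 b0; elim: k => [|k IH] /=.
  by rewrite !addr0 divff ?mulr1// gt_eqF// mulr_gt0.
rewrite IH -!natr1; have k0 : 0 <= k%:R :> R by [].
by field; rewrite !gt_eqF//; lra.
Qed.

(* The confluent hypergeometric function 1F1(a; b; x) *)
Definition kummer a b x : R := limn (pseries (kcoef a b) x).

Lemma is_cvg_kummer a b x : 0 < a -> a <= b -> cvgn (pseries (kcoef a b) x).
Proof.
move=> a0 ab; apply: is_cvg_pseries_inv_fact => k.
by rewrite gtr0_norm ?kcoef_le// kcoef_gt0// (lt_le_trans a0).
Qed.

Lemma kummerP a b x : 0 < a -> a <= b -> has_psum (kcoef a b) x (kummer a b x).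
Proof. by move=> a0 ab; exact: is_cvg_kummer. Qed.

Lemma kummer0 a b : kummer a b 0 = 1.
Proof. by apply/cvg_lim => //; exact: has_psum0. Qed.

Lemma kummer_ge1 a b x : 0 < a -> a <= b -> 0 <= x -> 1 <= kummer a b x.
Proof.
move=> a0 ab x0; rewrite -[leLHS](@mulr1 R); have b0 := lt_le_trans a0 ab.
apply: (@has_psum_le _ (fun k => (k == 0%N)%:R) (kcoef a b) x) => //.
- by case=> [|k] //=; rewrite ltW// (@kcoef_gt0 a b k.+1).
- rewrite /has_psum -cvg_shiftS /= (_ : (fun _ => _) = cst (1 * 1)).
    exact: cvg_cst.
  apply/funext => N; rewrite /pseries /series /= big_nat_recl //= expr0 mulr1.
  by rewrite big1 ?addr0// => i _; rewrite mul0r.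
- exact: kummerP.
Qed.

Lemma pseries_diffs_kcoef a b : 0 < a -> 0 < b ->
  pseries_diffs (kcoef a b) = (fun k => a / b * kcoef (a + 1) (b + 1) k).
Proof.
move=> a0 b0; apply/funext => k; rewrite /pseries_diffs /= kcoef_succlr//.
rewrite -natr1; have k0 : 0 <= k%:R :> R by [].
by field; rewrite !gt_eqF//; lra.
Qed.

Lemma is_derive_kummer a b x : 0 < a -> a <= b ->
  is_derive x 1 (kummer a b) (a / b * kummer (a + 1) (b + 1) x).
Proof.
move=> a0 ab; have b0 := lt_le_trans a0 ab.
have cvgZ k (c : R^nat) y : cvgn (pseries c y) ->
    cvgn (pseries (fun i => k * c i) y).
  by move=> h; apply/cvg_ex; exists (k * limn (pseries c y)); exact: has_psumZ.
have -> : a / b * kummer (a + 1) (b + 1) x =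
    limn (pseries (fun k => a / b * kcoef (a + 1) (b + 1) k) x).
  by apply/esym/cvg_lim => //; apply: has_psumZ; apply: kummerP; lra.
rewrite -pseries_diffs_kcoef//.
(* Termwise differentiation at [x] needs the series and its first two formal derivatives to converge
   at some point of larger modulus; [|x| + 1] is such a point. *)
apply: (@pseries_snd_diffs _ _ (`|x| + 1)).
- exact: is_cvg_kummer.
- by rewrite pseries_diffs_kcoef//; apply: cvgZ; apply: is_cvg_kummer; lra.
- rewrite (_ : pseries_diffs _ = fun k => a / b * ((a + 1) / (b + 1) *
      kcoef (a + 1 + 1) (b + 1 + 1) k)).
    apply: (cvgZ _ (fun k => (a + 1) / (b + 1) * _)); apply: cvgZ.
    by apply: is_cvg_kummer; lra.
  apply/funext => k; rewrite pseries_diffs_kcoef//.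
  have a1 : 0 < a + 1 by lra.
  have b1 : 0 < b + 1 by lra.
  have /(congr1 (@^~ k)) /= <- := pseries_diffs_kcoef a1 b1.
  by rewrite /pseries_diffs mulrCA.
by rewrite [ltRHS]ger0_norm// ltrDl.
Qed.

Definition ekummer a b z : R := expR (- z) * kummer a b z.

Lemma ekummer0 a b : ekummer a b 0 = 1.
Proof. by rewrite /ekummer oppr0 expR0 kummer0 mulr1. Qed.

Lemma ekummer_gt0 a b z : 0 < a -> a <= b -> 0 <= z -> 0 < ekummer a b z.
Proof.
move=> a0 ab z0; rewrite mulr_gt0 ?expR_gt0//.
by rewrite (lt_le_trans ltr01)// kummer_ge1.
Qed.

(** The left side is the derivative of [ekummer a b] with [expR (- z)] divided out. On coefficients
    the identity reads [(a + k) / (b + k) - 1 = - (b - a) / (b + k)]. *)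
Lemma kummer_contiguous a b z : 0 < a -> a <= b ->
  a / b * kummer (a + 1) (b + 1) z - kummer a b z =
  - ((b - a) / b) * kummer a (b + 1) z.
Proof.
move=> a0 ab; have b0 := lt_le_trans a0 ab.
apply: (@has_psum_unique _
  (fun k => a / b * kcoef (a + 1) (b + 1) k + -1 * kcoef a b k) z).
  rewrite -[- kummer _ _ _]mulN1r.
  by apply: has_psumD; apply: has_psumZ; apply: kummerP; lra.
rewrite (_ : (fun _ => _) = (fun k => - ((b - a) / b) * kcoef a (b + 1) k)).
  by apply: has_psumZ; apply: kummerP; lra.
apply/funext => k; rewrite kcoef_succlr// kcoef_succr//.
have k0 : 0 <= k%:R :> R by [].
by field; rewrite !gt_eqF//; lra.
Qed.

(** Differentiation raises [b] and leaves [a] fixed, so all derivatives stay in one family indexed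
    by [b + k]. *)
Lemma is_derive_ekummer a b z : 0 < a -> a <= b ->
  is_derive z 1 (ekummer a b) (- ((b - a) / b) * ekummer a (b + 1) z).
Proof.
move=> a0 ab; have b0 := lt_le_trans a0 ab.
have hk := @is_derive_kummer a b z a0 ab.
have he : is_derive z 1 (fun z => expR (- z)) (- expR (- z)).
  have := @is_derive1_comp _ _ (fun z => - z) z _ _ (is_derive_expR (- z))
    (@is_deriveN _ _ _ _ _ _ _ (is_derive_id _ _)).
  by rewrite mulrN1.
have -> : - ((b - a) / b) * ekummer a (b + 1) z =
   expR (- z) *: (a / b * kummer (a + 1) (b + 1) z) +
   kummer a b z *: (- expR (- z)).
  rewrite /ekummer mulrCA -kummer_contiguous// /GRing.scale /=; ring.
exact: is_deriveM.
Qed.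

(** This is [z f'' + (b + z) f' + (b - a) f = 0] divided by [b - a], with [f'] and [f''] replaced by
    their multiples of [ekummer a (b + 1)] and [ekummer a (b + 2)]. *)
Lemma ekummer_ode a b z : 0 < a -> a <= b ->
  z * ((b - a + 1) / (b * (b + 1)) * ekummer a (b + 2) z)
    - (b + z) / b * ekummer a (b + 1) z + ekummer a b z = 0.
Proof.
move=> a0 ab; have b0 := lt_le_trans a0 ab.
set p := (b - a + 1) / (b * (b + 1)).
have b2 : b + 2 = b + 1 + 1 by ring.
(* Terms are grouped by their power of [z], so that the bracket multiplied by [z] becomes a shifted
   series. *)
suff : z * (p * kummer a (b + 2) z + - b^-1 * kummer a (b + 1) z) +
    (kummer a b z + -1 * kummer a (b + 1) z) = 0.
  move=> /(congr1 (fun y => expR (- z) * y)); rewrite mulr0 => <-.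
  by rewrite /ekummer; field; rewrite gt_eqF.
apply: (@has_psum_unique _ (fun k =>
  (if k is j.+1 then p * kcoef a (b + 2) j + - b^-1 * kcoef a (b + 1) j else 0)
  + (kcoef a b k + -1 * kcoef a (b + 1) k)) z).
  apply: has_psumD.
    by apply: has_psum_shift; apply: has_psumD; apply: has_psumZ;
       apply: kummerP; lra.
  by apply: has_psumD; last apply: has_psumZ; apply: kummerP; lra.
rewrite (_ : (fun _ => _) = (fun k => 0 * kcoef a b k)).
  by have := @has_psumZ _ 0 _ _ _ (@kummerP a b z a0 ab); rewrite mul0r.
apply/funext => -[|k]; first by rewrite /=; ring.
have k0 : 0 <= k%:R :> R by [].
rewrite mul0r b2 (@kcoef_succr a (b + 1)) ?(@kcoef_succr a b)//; last lra.
by rewrite /= -natr1 /p; field; rewrite !gt_eqF//; lra.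
Qed.

(** This is [(z + c) f' + (b - a) f <= 0] with [f'] rewritten by [is_derive_ekummer] and positive
    factors removed. It holds coefficient by coefficient. *)
Lemma kummer_succr_ge a b z : 0 < a -> a <= b -> 0 <= z ->
  b * kummer a b z <= (z + (b + 1) * (a + 1)) * kummer a (b + 1) z.
Proof.
move=> a0 ab z0; have b0 := lt_le_trans a0 ab.
(* Degree 0 needs [b <= c]. In degree [k + 1] this [c] leaves, up to a positive factor, the surplus
   [(b + k + 1) + a (a b + a) + (a b + b + 1) k], whose terms are all nonnegative. *)
set c := (b + 1) * (a + 1); have cE : c = a * b + a + b + 1 by rewrite /c; ring.
have ab0 : 0 < a * b by rewrite mulr_gt0.
rewrite mulrDl; apply: (@has_psum_le _ (fun k => b * kcoef a b k) (fun k =>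
  (if k is j.+1 then kcoef a (b + 1) j else 0) + c * kcoef a (b + 1) k) z) => //.
- case=> [|k]; first by rewrite /= !mulr1 add0r; lra.
  rewrite !kcoef_succr// [kcoef a b k.+1]/= -!natr1.
  have k0 : 0 <= k%:R :> R by [].
  have /(@ler_wpM2l _ (kcoef a b k * (b / ((b + k%:R) * (k%:R + 1) *
      (b + (k%:R + 1)))))) : (a + k%:R) * (b + k%:R + 1) <=
      (k%:R + 1) * (b + k%:R + 1) + c * (a + k%:R).
    have -> : (k%:R + 1) * (b + k%:R + 1) + c * (a + k%:R) =
      (a + k%:R) * (b + k%:R + 1) + (b + k%:R + 1) * (1 - a) + c * (a + k%:R).
      ring.
    rewrite -subr_ge0 cE.
    have -> : (a + k%:R) * (b + k%:R + 1) + (b + k%:R + 1) * (1 - a) +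
      (a * b + a + b + 1) * (a + k%:R) - (a + k%:R) * (b + k%:R + 1) =
      (b + k%:R + 1) + a * (a * b + a) +
       (a * b + b + 1) * k%:R  by ring.
    by rewrite !addr_ge0 ?mulr_ge0 ?addr_ge0 ?mulr_ge0 ?(ltW a0) ?(ltW b0).
  move=> h; have {h}/h : 0 <= kcoef a b k * (b / ((b + k%:R) * (k%:R + 1) *
      (b + (k%:R + 1)))).
    rewrite mulr_ge0 ?divr_ge0 ?mulr_ge0 ?addr_ge0 ?(ltW a0) ?(ltW b0)//.
    by rewrite ltW// kcoef_gt0.
  congr (_ <= _); field; rewrite !gt_eqF//; lra.
- by apply: has_psumZ; exact: kummerP.
- by apply: has_psumD; [apply: has_psum_shift|apply: has_psumZ];
    apply: kummerP; lra.
Qed.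

(* With [c := (b + 1) * (a + 1)], the function
   [z |-> ekummer a b z * (z + c) `^ (b - a)] is nonincreasing on [0, +oo[. *)
Lemma ekummer_decay a b z : 0 < a -> a < b -> 0 <= z ->
  ekummer a b z <= (1 + z / ((b + 1) * (a + 1))) `^ (- (b - a)).
Proof.
move=> a0 ab z0; set c := (b + 1) * (a + 1); have b0 := lt_trans a0 ab.
have c0 : 0 < c by rewrite mulr_gt0// addr_gt0.
pose g := b - a; have g0 : 0 < g by rewrite subr_gt0.
pose G y := ekummer a b y * (y + c) `^ g.
have dG (y : R) : 0 <= y -> is_derive y 1 G
    (ekummer a b y * (g * (y + c) `^ (g - 1)) +
     (y + c) `^ g * (- (g / b) * ekummer a (b + 1) y)).
  move=> y0; have he := @is_derive_ekummer a b y a0 (ltW ab).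
  have yc : 0 < y + c by rewrite ltr_wpDl.
  have hp : is_derive y 1 (fun y => (y + c) `^ g) (g * (y + c) `^ (g - 1)).
    have := @is_derive1_comp _ (fun y => y `^ g) (fun y => y + c) y _ _
      (is_derive1_powR g yc) (is_deriveD (is_derive_id _ _) (is_derive_cst _ _ _)).
    by rewrite addr0 mulr1.
  exact: is_deriveM.
have : G z <= G 0.
  apply: (@ler0_derive1_nincry _ G 0) => //.
  - by move=> y; rewrite in_itv /= andbT => /ltW /dG h; exact: ex_derive.
  - move=> y; rewrite in_itv /= andbT => /ltW y0; rewrite derive1E.
    rewrite (@derive_val _ _ _ _ _ _ _ (dG y y0)).
    have yc : 0 < y + c by rewrite ltr_wpDl.
    have -> : (y + c) `^ g = (y + c) * (y + c) `^ (g - 1).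
      by rewrite mulr_powRB1// ltW.
    have -> : ekummer a b y * (g * (y + c) `^ (g - 1)) +
        (y + c) * (y + c) `^ (g - 1) * (- (g / b) * ekummer a (b + 1) y) =
        - ((y + c) `^ (g - 1) * (g / b * expR (- y)) *
          ((y + c) * kummer a (b + 1) y - b * kummer a b y)).
      by rewrite /ekummer; field; rewrite gt_eqF.
    rewrite oppr_le0 mulr_ge0 ?subr_ge0 ?kummer_succr_ge// ?(ltW ab)//.
    by rewrite mulr_ge0 ?powR_ge0 ?mulr_ge0 ?expR_ge0 ?invr_ge0 ?(ltW b0) ?(ltW g0).
  - apply/continuous_within_itvcyP; split => [y|].
      rewrite in_itv /= andbT => /ltW /dG h.
      by apply/differentiable_continuous/derivable1_diffP; exact: ex_derive.
    apply: cvg_at_right_filter; have h := dG 0 (lexx _).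
    apply/differentiable_continuous/derivable1_diffP.
    exact: ex_derive.
rewrite /G ekummer0 mul1r add0r powRN -/g => h.
have -> : 1 + z / c = (z + c) / c by field; rewrite gt_eqF.
have zc : 0 < z + c by rewrite ltr_wpDl.
rewrite powRM ?invr_ge0 ?(ltW zc) ?(ltW c0)//.
rewrite -(@powR_inv1 _ c) ?(ltW c0)// -powRrM mulN1r powRN invfM invrK [leRHS]mulrC.
by rewrite ler_pdivlMr ?powR_gt0.
Qed.

End kummer.

(** * Differentials of the coordinates and of the squared norm *)

Section differentials.
Variables (R : realType) (n : nat).
Local Notation pt := ('rV[R]_n * R)%type.
Implicit Types (p v : pt) (w x : 'rV[R]_n).

Lemma is_diff_sum (V W : normedModType R) m (f df : 'I_m -> V -> W) (x : V) :
  (forall i, is_diff x (f i) (df i)) ->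
  is_diff x (\sum_i f i) (\sum_i df i).
Proof.
move=> h; elim/big_ind2 : _ => //; first exact: is_diff_cst.
by move=> f1 df1 f2 df2 h1 h2; exact: is_diffD.
Qed.

Lemma is_diff_linear (V W : normedModType R) (f : V -> W) (x : V) :
  linear f -> continuous f -> is_diff x f f.
Proof.
move=> lf cf.
pose fL : {linear V -> W} := HB.pack f (GRing.isLinear.Build _ _ _ _ _ lf).
rewrite -[f]/(fL : V -> W); apply: DiffDef.
  exact: linear_differentiable.
exact: diff_lin.
Qed.

Lemma is_diff_derive1 (f : R -> R) (t d : R) :
  is_derive t 1 f d -> is_diff t f (fun h => h * d).
Proof.
move=> hf; have df : differentiable f t by apply/derivable1_diffP; exact: ex_derive.
apply: DiffDef => //; rewrite diff1E//; apply/funext => h.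
by rewrite derive1E derive_val.
Qed.

Lemma is_diff_snd p : is_diff p (snd : pt -> R) snd.
Proof. by apply: is_diff_linear => // q; exact: cvg_snd. Qed.

Lemma is_diff_coord p i :
  is_diff p (fun q : pt => q.1 0 i) (fun v : pt => v.1 0 i).
Proof.
apply: is_diff_linear => [k u v|q]; first by rewrite /= !mxE.
apply: (@continuous_comp _ _ _ (fst : pt -> _) (fun x : 'rV_n => x 0 i) q).
  exact: cvg_fst.
exact: coord_continuous.
Qed.

Definition dotv x w : R := \sum_i x 0 i * w 0 i.

Lemma dotvv_ge0 x : 0 <= dotv x x.
Proof. by apply: sumr_ge0 => i _; rewrite -expr2 sqr_ge0. Qed.

Lemma dotv_delta x i : dotv x (delta_mx 0 i) = x 0 i.
Proof.
rewrite /dotv (bigD1 i)//= mxE !eqxx mulr1 big1 ?addr0// => j ji.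
by rewrite mxE (negbTE ji) andbF mulr0.
Qed.

Lemma dotv0 x : dotv x 0 = 0.
Proof. by rewrite /dotv big1// => i _; rewrite mxE mulr0. Qed.

Lemma is_diff_dotv p w :
  is_diff p (fun q : pt => dotv q.1 w) (fun v : pt => dotv v.1 w).
Proof.
have := @is_diff_sum _ _ _ _ _ p (fun i =>
  is_diffM (is_diff_coord p i) (is_diff_cst (w 0 i) p)).
rewrite (_ : \sum_i _ = (fun q : pt => dotv q.1 w)); last first.
  by apply/funext => q; rewrite fct_sumE.
move=> h; apply: is_diff_eq h _; apply/funext => v.
rewrite fct_sumE; apply: eq_bigr => i _.
by rewrite /= !fctE /GRing.scale /= mulr0 add0r mulrC.
Qed.

Lemma is_diff_dotvv p :
  is_diff p (fun q : pt => dotv q.1 q.1) (fun v : pt => 2 * dotv p.1 v.1).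
Proof.
have := @is_diff_sum _ _ _ _ _ p (fun i =>
  is_diffM (is_diff_coord p i) (is_diff_coord p i)).
rewrite (_ : \sum_i _ = (fun q : pt => dotv q.1 q.1)); last first.
  by apply/funext => q; rewrite fct_sumE.
move=> h; apply: is_diff_eq h _; apply/funext => v.
rewrite fct_sumE mulr_sumr; apply: eq_bigr => i _.
by rewrite /= !fctE /GRing.scale /= mulr_natl mulr2n.
Qed.

End differentials.

(** * Smoothness through a syntax closed under differentiation *)

Section expressions.
Variables (R : realType) (n : nat) (a b : R).
Hypotheses (a0 : 0 < a) (ab : a < b).
Local Notation pt := ('rV[R]_n * R)%type.
Implicit Types (p v : pt).

(** A class of formulas containing the solution and stable under every directional derivative.
    Iterated derivatives become iterations of [dexpr], and smoothness follows from a single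
    induction on the syntax. *)
Inductive expr :=
| Cst of R
| Lin of 'rV[R]_n
| Sq
| Tpow of R
| Fk of nat
| Add of expr & expr
| Mul of expr & expr.

Definition simil p : R := dotv p.1 p.1 / (4 * p.2).

Fixpoint expr_eval (e : expr) (p : pt) : R :=
  match e with
  | Cst c => c
  | Lin w => dotv p.1 w
  | Sq => dotv p.1 p.1
  | Tpow s => p.2 `^ s
  | Fk k => ekummer a (b + k%:R) (simil p)
  | Add e1 e2 => expr_eval e1 p + expr_eval e2 p
  | Mul e1 e2 => expr_eval e1 p * expr_eval e2 p
  end.

(** The differential [x.v / (2 t) - |x|^2 v_t / (4 t^2)] of [simil], with inverse powers of [t]
    expressed by [Tpow] to remain inside the syntax. *)
Definition dsimil v : expr :=
  Add (Mul (Mul (Lin v.1) (Cst (1 / 2))) (Tpow (- 1)))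
      (Mul (Mul Sq (Cst (- v.2 / 4))) (Tpow (- 2))).

Fixpoint dexpr v (e : expr) : expr :=
  match e with
  | Cst c => Cst 0
  | Lin w => Cst (dotv v.1 w)
  | Sq => Mul (Cst 2) (Lin v.1)
  | Tpow s => Mul (Cst (v.2 * s)) (Tpow (s - 1))
  | Fk k => Mul (Mul (Cst (- ((b + k%:R - a) / (b + k%:R)))) (Fk k.+1)) (dsimil v)
  | Add e1 e2 => Add (dexpr v e1) (dexpr v e2)
  | Mul e1 e2 => Add (Mul (dexpr v e1) e2) (Mul e1 (dexpr v e2))
  end.

Lemma powRN2 (t : R) : 0 < t -> t `^ (- 2) = t^-1 * t^-1.
Proof. by move=> t0; rewrite powR_invn ?ltW// expr2 invfM. Qed.

Lemma is_diff_simil p : 0 < p.2 ->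
  is_diff p simil (fun v => expr_eval (dsimil v) p).
Proof.
move=> p0.
have hV : is_derive p.2 1 (fun t : R => (4 * t)^-1) (- (4 * p.2) ^- 2 *: 4).
  have h4 : is_derive p.2 1 (fun t : R => 4 * t) 4.
    have := @is_deriveZ R R^o R^o id 4 p.2 1 1 (is_derive_id _ _).
    by rewrite /GRing.scale /= mulr1.
  apply: DeriveDef.
    by apply: derivableV; rewrite ?gt_eqF ?mulr_gt0//; exact: ex_derive.
  by rewrite deriveV ?gt_eqF ?mulr_gt0// ?derive_val//; exact: ex_derive.
have h := is_diffM (is_diff_dotvv p)
  (@is_diff_comp _ _ _ _ _ _ _ _ _ (is_diff_snd p) (is_diff_derive1 hV)).
apply: is_diff_eq h _; apply/funext => v.
rewrite /= !fctE /GRing.scale /= powRN2// powR_inv1 ?ltW//.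
by field; rewrite gt_eqF.
Qed.

(** Full differentiability is proved because it yields both continuity and all directional
    derivatives. *)
Lemma is_diff_eval e p : 0 < p.2 ->
  is_diff p (expr_eval e) (fun v => expr_eval (dexpr v e) p).
Proof.
move=> p0; elim: e => [c|w||s|k|e1 h1 e2 h2|e1 h1 e2 h2].
- exact: is_diff_cst.
- exact: is_diff_dotv.
- exact: is_diff_dotvv.
- have h := @is_diff_comp _ _ _ _ _ _ _ _ _ (is_diff_snd p)
    (is_diff_derive1 (is_derive1_powR s p0)).
  by apply: is_diff_eq h _; apply/funext => v; rewrite /= mulrA.
- have abk : a <= b + k%:R by rewrite (le_trans (ltW ab))// lerDl.
  have h := @is_diff_comp _ _ _ _ _ _ _ _ _ (is_diff_simil p0)
    (is_diff_derive1 (is_derive_ekummer (simil p) a0 abk)).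
  apply: is_diff_eq h _; apply/funext => v.
  by rewrite /comp mulrC -(addrA b k%:R 1) natr1.
- exact: is_diffD.
- have h := is_diffM h1 h2.
  apply: is_diff_eq h _; apply/funext => v.
  by rewrite /= !fctE /GRing.scale /= addrC [expr_eval e2 p * _]mulrC.
Qed.

Lemma near_upper_half p : upper_half p -> \forall q \near p, upper_half q.
Proof.
move=> p0; have : \forall t \near p.2, 0 < t by exact: lt_nbhsr.
by move=> h; exact: (cvg_snd h).
Qed.

Lemma derive_eval e v p : 0 < p.2 -> 'D_v (expr_eval e) p = expr_eval (dexpr v e) p.
Proof.
move=> p0; have h := is_diff_eval e p0.
by rewrite deriveE ?diff_val//; exact: ex_diff.
Qed.

Lemma iter_dir_eval e vs p : 0 < p.2 ->
  iter_dir vs (expr_eval e) p = expr_eval (foldr dexpr e vs) p.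
Proof.
elim: vs p => [//|v vs IH] p p0 /=; rewrite -derive_eval//.
(* The induction hypothesis holds only where [t > 0]; this set is open, and a derivative depends
   only on values near the point. *)
apply: near_eq_derive; apply: filterS (near_upper_half p0) => q; exact: IH.
Qed.

Lemma smooth_on_eval e : smooth_on (@upper_half R n) (expr_eval e).
Proof.
move=> vs p p0; set g := foldr dexpr e vs.
have gE : \forall q \near p, expr_eval g q = iter_dir vs (expr_eval e) q.
  by apply: filterS (near_upper_half p0) => q q0; rewrite iter_dir_eval.
have h := is_diff_eval g p0; have dg : differentiable (expr_eval g) p by exact: ex_diff.
split=> [|v]; last by apply: near_eq_derivable gE _; exact: diff_derivable.
apply: cvg_trans (near_eq_cvg gE) _.
by rewrite iter_dir_eval//; exact: differentiable_continuous.
Qed.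

End expressions.

(** The chain rule expresses both the time derivative and the Laplacian through [f_b], [f_(b+1)] and
    [f_(b+2)] at the similarity variable; their difference is [- gamma t^(- gamma - 1)] times the
    left side of [ekummer_ode]. *)
Lemma heat_op_ekummer (R : realType) (n : nat) (gamma : R) :
  (0 < n)%N -> 0 < gamma < n%:R / 2 ->
  forall p : 'rV[R]_n * R, upper_half p ->
  heat_op (expr_eval (n%:R / 2 - gamma) (n%:R / 2)
    (Mul (Tpow _ (- gamma)) (Fk _ _ 0))) p = 0.
Proof.
move=> n0 /andP[g0 gb] p p0; set b := n%:R / 2; set a := b - gamma; set e := Mul _ _.
have b0 : 0 < b by rewrite divr_gt0// ltr0n.
have a0 : 0 < a by rewrite subr_gt0.
have ab : a < b by rewrite /a; lra.
rewrite /heat_op derive_eval//.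
rewrite (eq_bigr (fun i =>
  expr_eval a b (dexpr a b (e_x R i) (dexpr a b (e_x R i) e)) p)).
  have := ekummer_ode (simil p) a0 (ltW ab).
  rewrite /e /= !addr0; set t := p.2; set q := dotv p.1 p.1.
  rewrite /simil -/t -/q.
  set H0 := ekummer a b _; set H1 := ekummer a (b + 1) _.
  set H2 := ekummer _ _ _ => ode.
  have t0 : 0 < t := p0.
  have bag : b - a = gamma by rewrite /a; ring.
  have bag1 : b + 1 - a = gamma + 1 by rewrite -bag; ring.
  have tg : t `^ (- gamma - 1) = t `^ (- gamma) / t.
    by rewrite powRB ?powRr1 ?(ltW t0)// (gt_eqF t0) implybT.
  move: ode; rewrite bag bag1 tg powRN2// powR_inv1 ?ltW// dotv0.
  set P := t `^ (- gamma) => ode.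
  (* The second derivative along [x_i] is [K1 x_i^2 + K2]: [K1] collects the [f''] term and [K2] the
     [f'] term. *)
  pose K1 := P * (gamma / b) * ((gamma + 1) / (b + 1)) * H2 / (4 * t * t).
  pose K2 := - (P * (gamma / b) * H1 / (2 * t)).
  rewrite (eq_bigr (fun i => K1 * (p.1 0 i * p.1 0 i) + K2)); last first.
    move=> i _; rewrite !dotv_delta !mxE !eqxx /K1 /K2 /=.
    by field; rewrite !gt_eqF//; lra.
  rewrite big_split /= -mulr_sumr -/(dotv p.1 p.1) -/q.
  (* The choice [b = n / 2] enters here: the [n] copies of [K2] must match the coefficient [b] of
     the differential equation. *)
  rewrite sumr_const card_ord -[K2 *+ n]mulr_natr (_ : n%:R = b * 2); last first.
    by rewrite /b mulfVK// pnatr_eq0.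
  rewrite -[RHS](mulr0 (- (P * gamma / t))) -[X in _ = _ * X]ode /K1 /K2.
  by field; rewrite !gt_eqF//; lra.
move=> i _; rewrite -derive_eval//.
apply: near_eq_derive; apply: filterS (near_upper_half p0) => q q0.
by rewrite derive_eval.
Qed.

(* Unlike [ge0_le_integral], this asks for no measurability: the integral of a
   nonnegative function is a supremum over the simple functions below it. *)
Lemma ge0_le_integral_nomeas (d : measure_display) (T : measurableType d)
    (R : realType) (mu : {measure set T -> \bar R}) (D : set T)
    (f1 f2 : T -> \bar R) :
  (forall x, D x -> 0 <= f1 x)%E -> (forall x, D x -> f1 x <= f2 x)%E ->
  (\int[mu]_(x in D) f1 x <= \int[mu]_(x in D) f2 x)%E.
Proof.
move=> f10 f12; have f20 x : D x -> (0 <= f2 x)%E.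
  by move=> Dx; exact: le_trans (f10 x Dx) (f12 x Dx).
rewrite !ge0_integralE//; apply: ereal_sup_le => _ [h hf1 <-]; exists h => //= x.
apply: le_trans (hf1 x) _; rewrite !patchE; case: ifPn => // xD.
by apply: f12; rewrite inE in xD.
Qed.

(** * One-variable improper integrals of powers *)

Section one_variable.
Variable R : realType.
Local Notation mu := (@lebesgue_measure R).

Lemma is_derive_continuous (f : R -> R) (x d : R) :
  is_derive x 1 f d -> {for x, continuous f}.
Proof.
by move=> h; apply/differentiable_continuous/derivable1_diffP; exact: ex_derive.
Qed.

(** Monotone convergence along the compact intervals, with the fundamental theorem of calculus on
    each. It serves both the singularity at 0 and the tail at infinity. *)
Lemma integral_bigcup_itv_le (f F : R -> R) (a b : nat -> R) (K : R) :
  let D := \bigcup_i `[a i, b i]%classic in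
  nondecreasing_seq (fun i => `[a i, b i]%classic) ->
  (forall i, a i < b i) ->
  (forall x, D x -> 0 <= f x) ->
  (forall x, D x -> derivable f x 1) ->
  (forall x, D x -> is_derive x 1 F (f x)) ->
  (forall i, F (b i) - F (a i) <= K) ->
  (\int[mu]_(x in D) (f x)%:E <= K%:E)%E.
Proof.
move=> D nd ab f0 df dF hK.
have inD i x : `[a i, b i]%classic x -> D x by exists i.
have cf i : {within `[a i, b i], continuous f}.
  by apply: derivable_within_continuous => x xab; apply: df; exact: (inD i).
have mi i : measurable `[a i, b i]%classic by exact: measurable_itv.
have mf i : measurable_fun `[a i, b i]%classic (EFin \o f).
  by apply/measurable_EFinP; exact: subspace_continuous_measurable_fun.
have f0i i x : `[a i, b i]%classic x -> (0 <= (f x)%:E)%E.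
  by move=> xi; rewrite lee_fin; exact: f0 (inD _ _ xi).
have cvgi : (\int[mu]_(x in `[a i, b i]) (f x)%:E @[i --> \oo] -->
    \int[mu]_(x in D) (f x)%:E)%E.
  exact: (@ge0_nondecreasing_set_cvg_integral _ (measurableTypeR R) R
    (fun i => `[a i, b i]%classic) (fun x => (f x)%:E) lebesgue_measure).
rewrite -(cvg_lim _ cvgi)//.
apply: lime_le.
  apply: ereal_nondecreasing_is_cvgn.
  exact: ge0_nondecreasing_set_nondecreasing_integral.
apply: nearW => i; rewrite (@continuous_FTC2 _ f F)//.
- by rewrite -EFinB lee_fin.
- have ai : D (a i) by apply: (inD i); rewrite /= in_itv /= lexx ltW.
  have bi : D (b i) by apply: (inD i); rewrite /= in_itv /= lexx ltW.
  split.
  + move=> x xab; have : D x by apply: (inD i); exact: subset_itv_oo_cc.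
    by move=> /dF h; exact: ex_derive.
  + by apply: cvg_at_right_filter; exact: is_derive_continuous (dF _ ai).
  + by apply: cvg_at_left_filter; exact: is_derive_continuous (dF _ bi).
- move=> x xab; have : D x by apply: (inD i); exact: subset_itv_oo_cc.
  by move=> /dF h; rewrite derive1E derive_val.
Qed.

Lemma integral_powR_near0 (T d : R) : 0 < T -> 0 < d ->
  (\int[mu]_(t in `]0%R, T[) (t `^ (d - 1))%:E <= (T `^ d / d)%:E)%E.
Proof.
move=> T0 d0.
rewrite integral_itv_bndo_bndc; last first.
  by apply/measurable_EFinP/measurable_funTS; exact: measurable_powR.
(* The index starts at 2 so that even the first interval is nondegenerate. *)
have -> : `]0, T]%classic = \bigcup_i `[T / i.+2%:R, T]%classic.
  apply/seteqP; split => x /=; rewrite in_itv /=.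
    move=> /andP[x0 xT]; exists (Num.truncn (T / x)) => //=.
    rewrite in_itv /= xT andbT ler_pdivrMr// mulrC -ler_pdivrMr//.
    by rewrite (le_trans (ltW (truncnS_gt _)))// ler_nat.
  move=> [i _]; rewrite /= in_itv /= => /andP[+ ->]; rewrite andbT.
  by apply: lt_le_trans; rewrite divr_gt0.
have pos i x : `[T / i.+2%:R, T]%classic x -> 0 < x.
  by rewrite /= in_itv /= => /andP[+ _]; apply: lt_le_trans; rewrite divr_gt0.
apply: (@integral_bigcup_itv_le _ (fun t => t `^ d / d) _ (fun=> T)).
- move=> i j ij; rewrite subsetEset => x; rewrite /= !in_itv /= => /andP[h ->].
  by rewrite andbT (le_trans _ h)// ler_pM2l// lef_pV2 ?posrE// ler_nat !ltnS.
- by move=> i; rewrite ltr_pdivrMr// ltr_pMr// ltr1n.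
- by move=> x _; exact: powR_ge0.
- by move=> x [i _ /pos x0]; apply: derivable_powR; rewrite in_itv /= x0.
- move=> x [i _ /pos x0].
  have h := @is_deriveZ R R^o R^o (fun t => t `^ d) d^-1 x 1 _ (is_derive1_powR d x0).
  have -> : (fun t => t `^ d / d) = d^-1 \*: (fun t => t `^ d).
    by apply/funext => t; rewrite /= mulrC.
  by apply: is_derive_eq h _; rewrite /GRing.scale /= mulKf// gt_eqF.
- by move=> i; rewrite gerBl divr_ge0 ?powR_ge0 ?ltW.
Qed.

Lemma integral_powR_tail (tau r : R) : 0 < tau -> 1 < r ->
  (\int[mu]_(y in [set: R]) ((1 + `|y| / tau) `^ (- r))%:E
   <= (2 / (r - 1) * tau)%:E)%E.
Proof.
move=> tau0 r1; have r0 : 0 < r - 1 by lra.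
have pos (y : R) : 0 <= y -> 0 < 1 + y / tau.
  by move=> y0; rewrite ltr_wpDr// divr_ge0// ltW.
have dpow s (y : R) : 0 <= y ->
    is_derive y 1 (fun y => (1 + y / tau) `^ s) (s * (1 + y / tau) `^ (s - 1) / tau).
  move=> y0; have hl : is_derive y 1 (fun y => 1 + y / tau) tau^-1.
    have := @is_deriveZ R R^o R^o id tau^-1 y 1 1 (is_derive_id _ _).
    move=> /(is_deriveD (is_derive_cst (1 : R^o) (y : R^o) (1 : R^o))) h.
    have -> : (fun y => 1 + y / tau) = cst 1 + tau^-1 \*: id.
      by apply/funext => z; rewrite !fctE /GRing.scale /= mulrC.
    by apply: is_derive_eq h _; rewrite add0r /GRing.scale /= mulr1.
  exact: (@is_derive1_comp _ (fun z => z `^ s) (fun y => 1 + y / tau) y _ _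
    (is_derive1_powR s (pos y y0)) hl).
(* By evenness the integral is twice that over the half-line, whence the 2 in the bound. *)
rewrite (@ge0_symfun_integralT _ (fun y => (1 + `|y| / tau) `^ (- r)))//.
- have -> : (2 / (r - 1) * tau)%:E = (2%:E * (tau / (r - 1))%:E)%E.
    by rewrite -EFinM; congr EFin; ring.
  rewrite lee_pmul2l//.
  have -> : [set x : R | 0 <= x] = \bigcup_i `[0, i.+1%:R]%classic.
    apply/seteqP; split => x /=; last first.
      by move=> [i _]; rewrite /= in_itv /= => /andP[].
    move=> x0; exists (Num.truncn x) => //=; rewrite in_itv /= x0 /=.
    by rewrite ltW// truncnS_gt.
  set D := \bigcup_i _.
  apply: (@le_trans _ _ (\int[mu]_(y in D) ((1 + y / tau) `^ (- r))%:E)%E).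
    apply: ge0_le_integral_nomeas => y; first by rewrite lee_fin powR_ge0.
    by move=> [i _]; rewrite /= in_itv /= => /andP[y0 _]; rewrite ger0_norm.
  have ge0 i (x : R) : `[0, i.+1%:R]%classic x -> 0 <= x.
    by rewrite /= in_itv /= => /andP[].
  apply: (@integral_bigcup_itv_le _
    (fun y => - (tau / (r - 1)) * (1 + y / tau) `^ (1 - r))
    (fun=> 0) (fun i => i.+1%:R)).
  + move=> i j ij; rewrite subsetEset => x; rewrite /= !in_itv /= => /andP[-> h] /=.
    by rewrite (le_trans h)// ler_nat.
  + by move=> i; rewrite ltr0n.
  + by move=> x _; exact: powR_ge0.
  + by move=> x [i _ /ge0 x0]; have h := dpow (- r) x x0; exact: ex_derive.
  + move=> x [i _ /ge0 x0].
    have h := @is_deriveZ R R^o R^o _ (- (tau / (r - 1))) x 1 _ (dpow (1 - r) x x0).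
    apply: is_derive_eq h _; rewrite /GRing.scale /=.
    rewrite (_ : 1 - r - 1 = - r); last ring.
    by field; rewrite !gt_eqF.
  + move=> i; rewrite mul0r addr0 powR1 mulr1 opprK mulNr addrC gerBl.
    by rewrite mulr_ge0 ?powR_ge0// divr_ge0 ?ltW.
- by move=> y; exact: powR_ge0.
- move=> y; have p0 := pos _ (normr_ge0 y).
  apply: (@continuous_comp _ _ _ (fun y : R => 1 + `|y| / tau) (fun z => z `^ (- r))).
    apply: cvgD; first exact: cvg_cst.
    by apply: cvgM; [exact: norm_continuous|exact: cvg_cst].
  exact: is_derive_continuous (is_derive1_powR _ p0).
- by move=> y; rewrite /= normrN.
Qed.

End one_variable.

(** * Integrals over R^n dominated by products of one-variable integrals *)

Section iterated_integral.
Variables (R : realType) (n : nat) (g : 'rV[R]_n -> \bar R).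
Variables (phi : R -> R) (A C : R).
Hypotheses (C0 : 0 <= C) (A0 : 0 <= A).
Hypotheses (phi0 : forall y, 0 <= phi y) (mphi : measurable_fun [set: R] phi).
Hypothesis int_phi :
  (\int[lebesgue_measure]_(y in [set: R]) (phi y)%:E <= A%:E)%E.
Hypothesis g0 : forall x, (0 <= g x)%E.
Hypothesis g_le : forall x, (g x <= (C * \prod_j phi (x ord0 j))%:E)%E.

Lemma iint_coords_ge0 k x : (0 <= iint_coords k g x)%E.
Proof. by elim: k x => [//|k IH] x /=; exact: integral_ge0. Qed.

(** Every coordinate already integrated has contributed a factor [A]; those of index at least [k]
    are still frozen and keep their [phi]. *)
Lemma iint_coords_le k x : (k <= n)%N ->
  (iint_coords k g x <=
   (C * A ^+ k * \prod_(j < n | (k <= j)%N) phi (x ord0 j))%:E)%E.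
Proof.
elim: k x => [|k IH] x kn /=; first by rewrite expr0 mulr1.
set Q := \prod_(j < n | (k.+1 <= j)%N) phi (x ord0 j).
have Q0 : 0 <= Q by apply: prodr_ge0.
have CA0 : 0 <= C * A ^+ k by rewrite mulr_ge0// exprn_ge0.
apply: (@le_trans _ _ (\int[lebesgue_measure]_(y in [set: R])
    ((C * A ^+ k * Q)%:E * (phi y)%:E))%E).
  apply: ge0_le_integral_nomeas => y _; first exact: iint_coords_ge0.
  apply: le_trans (IH _ (ltnW kn)) _; rewrite -EFinM lee_fin -[leRHS]mulrA ler_wpM2l//.
  (* The factor of index [k] is the one evaluated at the integration variable [y]; the rest is
     [Q]. *)
  rewrite (bigD1 (Ordinal kn))//= mxE eqxx mulrC ler_wpM2r//.
  rewrite (eq_bigl (fun j : 'I_n => (k < j)%N)); last first.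
    by move=> j; rewrite ltn_neqAle andbC -val_eqE /= eq_sym.
  rewrite le_eqVlt; apply/orP; left; apply/eqP; apply: eq_bigr => j kj.
  by rewrite mxE gtn_eqF.
rewrite ge0_integralZl//.
- apply: (@le_trans _ _ ((C * A ^+ k * Q)%:E * A%:E)%E).
    by apply: lee_wpmul2l => //; rewrite lee_fin mulr_ge0.
  rewrite -EFinM exprSr (_ : C * (A ^+ k * A) * Q = C * A ^+ k * Q * A)//; ring.
- exact/measurable_EFinP.
- by move=> y _; rewrite lee_fin.
- by rewrite lee_fin mulr_ge0.
Qed.

Lemma int_Rn_le : (int_Rn g <= (C * A ^+ n)%:E)%E.
Proof.
apply: le_trans (iint_coords_le 0 (leqnn n)) _; rewrite big_pred0 ?mulr1//.
by move=> j; rewrite leqNgt ltn_ord.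
Qed.

End iterated_integral.

(* Each coordinate satisfies [2 (1 + |x|^2/tau^2) >= (1 + |x_j|/tau)^2]. *)
Lemma powR_dotv_le_prod (R : realType) (n : nat) (tau q : R) (x : 'rV[R]_n) :
  (0 < n)%N -> 0 < tau -> 0 <= q ->
  (1 + dotv x x / tau ^+ 2) `^ (- q) <=
  2 `^ q * \prod_j (1 + `|x ord0 j| / tau) `^ (- (2 * q / n%:R)).
Proof.
move=> n0 tau0 q0; set Z := 1 + _.
have nR0 : 0 < n%:R :> R by rewrite ltr0n.
have Z1 : 1 <= Z by rewrite lerDl divr_ge0 ?dotvv_ge0 ?sqr_ge0.
have Z0 : 0 < 2 * Z by rewrite mulr_gt0// (lt_le_trans ltr01).
have -> : Z `^ (- q) = 2 `^ q * (2 * Z) `^ (- q).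
  rewrite powRM// ?(le_trans ler01)// mulrA -powRD ?subrr ?powRr0 ?mul1r//.
  by rewrite pnatr_eq0 implybT.
rewrite ler_wpM2l ?powR_ge0//.
(* The exponent is shared equally among the [n] factors, each then bounded through its own
   coordinate. *)
have -> : (2 * Z) `^ (- q) = \prod_(j < n) (2 * Z) `^ (- (q / n%:R)).
  rewrite prodr_const card_ord -powR_mulrn ?powR_ge0// -powRrM mulNr divfK//.
  by rewrite gt_eqF.
apply: ler_prod => j _; rewrite powR_ge0 /=.
set y := `|x ord0 j| / tau.
have y0 : 0 <= y by rewrite divr_ge0// ltW.
have yZ : (1 + y) ^+ 2 <= 2 * Z.
  have : y ^+ 2 <= dotv x x / tau ^+ 2.
    rewrite /y exprMn exprVn ler_wpM2r ?invr_ge0 ?sqr_ge0//.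
    rewrite /dotv (bigD1 j)//= real_normK ?num_real// expr2 lerDl.
    by apply: sumr_ge0 => i _; rewrite -expr2 sqr_ge0.
  have := sqr_ge0 (1 - y); rewrite /Z !sqrrD; lra.
have -> : (1 + y) `^ (- (2 * q / n%:R)) = ((1 + y) ^+ 2) `^ (- (q / n%:R)).
  by rewrite -powR_mulrn ?addr_ge0// -powRrM; congr (_ `^ _); ring.
rewrite !powRN lef_pV2 ?posrE ?powR_gt0//; last by rewrite exprn_gt0// ltr_wpDr.
by rewrite ge0_ler_powR ?nnegrE ?divr_ge0 ?exprn_ge0 ?addr_ge0// ltW.
Qed.

(** The decay of [f] dominates each time slice by a product of one-variable tails of width [tau],
    each of integral at most [A * tau]. Since [tau] scales like the square root of [t], the slice
    contributes at most [K t^(d - 1)], integrable at 0. *)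
Lemma Llambda_strip_selfsimilar (R : realType) (n : nat) (gamma lambda eps T c : R)
    (f : R -> R) :
  (0 < n)%N -> 0 < T -> 0 < c -> 0 < eps < 2 -> 0 < lambda -> 0 < gamma ->
  gamma * lambda = (n%:R + 2 - eps) / 2 ->
  (forall z, 0 <= z -> 0 < f z <= (1 + z / c) `^ (- gamma)) ->
  in_Llambda_strip lambda T
    (fun p : 'rV[R]_n * R => p.2 `^ (- gamma) * f (dotv p.1 p.1 / (4 * p.2))).
Proof.
move=> n0 T0 c0 /andP[e0 e2] l0 g0 gl hf.
have nR0 : 0 < n%:R :> R by rewrite ltr0n.
pose q := gamma * lambda; pose r := 2 * q / n%:R.
have q0 : 0 < q by rewrite mulr_gt0.
(* [2 q = n + 2 - eps] exceeds [n] because [eps < 2]; hence each tail is integrable. *)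
have r1 : 1 < r by rewrite /r /q gl ltr_pdivlMr//; lra.
pose A := 2 / (r - 1).
have A0 : 0 <= A by rewrite divr_ge0// subr_ge0 ltW.
pose K := 2 `^ q * (A * Num.sqrt (4 * c)) ^+ n.
have K0 : 0 <= K by rewrite mulr_ge0 ?powR_ge0// exprn_ge0// mulr_ge0 ?sqrtr_ge0.
pose d := eps / 2; have d0 : 0 < d by rewrite divr_gt0.
apply: (@le_lt_trans _ _ (K%:E * \int[lebesgue_measure]_(t in `]0%R, T[)
    (t `^ (d - 1))%:E)%E); last first.
  apply: (@le_lt_trans _ _ (K%:E * (T `^ d / d)%:E)%E); last by rewrite -EFinM ltry.
  by apply: lee_wpmul2l; [rewrite lee_fin|exact: integral_powR_near0].
rewrite -ge0_integralZl//; last 2 first.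
- by apply/measurable_EFinP/measurable_funTS; exact: measurable_powR.
- by move=> t _; rewrite lee_fin powR_ge0.
apply: ge0_le_integral_nomeas => t; rewrite /= in_itv /= => /andP[t0 tT].
  by apply: iint_coords_ge0 => x; rewrite lee_fin powR_ge0.
(* Chosen so that [|x|^2 / (4 t c) = |x|^2 / tau^2]. *)
pose tau := Num.sqrt (4 * c * t).
have ct0 : 0 < 4 * c * t by rewrite !mulr_gt0.
have tau0 : 0 < tau by rewrite sqrtr_gt0.
apply: (le_trans (@int_Rn_le R n _ (fun y => (1 + `|y| / tau) `^ (- r))
   (A * tau) (t `^ (- q) * 2 `^ q) _ _ _ _ _ _ _)).
- by rewrite mulr_ge0 ?powR_ge0.
- by rewrite mulr_ge0// ltW.
- by move=> y; exact: powR_ge0.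
- apply: (@measurableT_comp _ _ _ _ _ _ (fun z : R => z `^ (- r))).
    exact: measurable_powR.
  by apply: measurable_funD => //; exact: measurable_funM.
- exact: integral_powR_tail.
- by move=> x; rewrite lee_fin powR_ge0.
- move=> x; rewrite lee_fin.
  have z0 : 0 <= dotv x x / (4 * t) by rewrite divr_ge0 ?dotvv_ge0// mulr_ge0// ltW.
  have /andP[f0 fle] := hf _ z0.
  rewrite ger0_norm ?mulr_ge0 ?powR_ge0 ?(ltW f0)//.
  rewrite powRM ?powR_ge0 ?(ltW f0)// -powRrM mulNr -/q -mulrA ler_wpM2l ?powR_ge0//.
  apply: le_trans (powR_dotv_le_prod x n0 tau0 (ltW q0)).
  have -> : dotv x x / tau ^+ 2 = dotv x x / (4 * t) / c.
    by rewrite sqr_sqrtr ?(ltW ct0)//; field; rewrite !gt_eqF.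
  rewrite /q -mulNr powRrM ge0_ler_powR ?nnegrE ?powR_ge0 ?(ltW f0) ?(ltW l0)//.
have -> : A * tau = A * Num.sqrt (4 * c) * t `^ 2^-1.
  by rewrite powR12_sqrt ?(ltW t0)// -mulrA -sqrtrM// mulr_ge0 ?(ltW c0).
rewrite -EFinM lee_fin /K exprMn -(powR_mulrn n (powR_ge0 t _)) -powRrM.
have -> : d - 1 = - q + 2^-1 * n%:R by rewrite /q gl /d; field.
rewrite powRD; last by rewrite (gt_eqF t0) implybT.
rewrite le_eqVlt; apply/orP; left; apply/eqP; ring.
Qed.

Theorem theorem1p2 (R : realType) (n : nat) (lambda gamma eps : R) :
  (1 <= n)%N ->
  (n.+2)%:R / n%:R <= lambda ->
  0 < eps < 1 ->
  gamma = ((n.+2)%:R - eps) / (2 * lambda) ->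
  exists u : 'rV[R]_n * R -> R,
    [/\ smooth_on (@upper_half R n) u,
        (forall p, upper_half p -> 0 < u p),
        (forall p, upper_half p -> heat_op u p = 0),
        (forall T : R, 0 < T -> in_Llambda_strip lambda T u) &
        (forall t : R, 0 < t -> u (0, t) = t `^ (- gamma))].
Proof.
move=> n0 hl /andP[e0 e1] gE.
have nR0 : 0 < n%:R :> R by rewrite ltr0n.
have nE : n.+2%:R = n%:R + 2 :> R by rewrite -natrD addn2.
have l0 : 0 < lambda by apply: lt_le_trans hl; rewrite divr_gt0.
have g0 : 0 < gamma by rewrite gE divr_gt0 ?mulr_gt0// nE; lra.
have gl : gamma * lambda = (n%:R + 2 - eps) / 2.
  by rewrite gE nE; field; rewrite gt_eqF.
pose b := n%:R / 2 : R.
(* The lower bound on [lambda] gives [gamma lambda = (n + 2 - eps) / 2 < (n + 2) / 2 <= lambda n /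
   2]. This makes [a] positive. *)
have gb : gamma < b.
  rewrite -(ltr_pM2r l0) gl; move: hl; rewrite ler_pdivrMr// nE /b; lra.
pose a := b - gamma; have a0 : 0 < a by rewrite subr_gt0.
have ab : a < b by rewrite /a; lra.
have simil_ge0 (p : 'rV[R]_n * R) : 0 < p.2 -> 0 <= simil p.
  by move=> p0; rewrite divr_ge0 ?dotvv_ge0// mulr_ge0// ltW.
exists (expr_eval a b (Mul (Tpow n (- gamma)) (Fk R n 0))); split.
- exact: smooth_on_eval.
- move=> p p0; rewrite /= addr0 mulr_gt0 ?powR_gt0// ekummer_gt0 ?(ltW ab)//.
  exact: simil_ge0.
- by apply: heat_op_ekummer => //; rewrite g0.
- move=> T T0.
  rewrite (_ : expr_eval _ _ _ = fun p : 'rV[R]_n * R =>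
    p.2 `^ (- gamma) * ekummer a b (dotv p.1 p.1 / (4 * p.2))); last first.
    by apply/funext => p; rewrite /= addr0.
  apply: (@Llambda_strip_selfsimilar _ _ _ _ eps _ ((b + 1) * (a + 1))) => //.
  + by rewrite mulr_gt0//; lra.
  + by rewrite e0; lra.
  + move=> z z0; rewrite ekummer_gt0 ?(ltW ab)//=.
    by have := ekummer_decay a0 ab z0; rewrite (_ : b - a = gamma)// /a; ring.
(* At [x = 0] the similarity variable vanishes and [f 0 = 1]. *)
- by move=> t t0; rewrite /= /simil dotv0 mul0r addr0 ekummer0 mulr1.
Qed.
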